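(* Let $\alpha<\beta$ be real numbers and let $\mathbf{x}=(x_1,\dots,x_l)\in[\alpha,\beta]^l$, $\mathbf{y}=(y_1,\dots,y_m)\in[\alpha,\beta]^m$, $\mathbf{a}=(a_1,\dots,a_l)\in[0,\infty)^l$ and $\mathbf{b}=(b_1,\dots,b_m)\in[0,\infty)^m$ be such that $(\mathbf{y},\mathbf{b})\prec(\mathbf{x},\mathbf{a})$. Then for every function $f:[\alpha,\beta]\to\mathbb{R}$ that is strongly convex with modulus $c>0$, $$\sum_{i=1}^{m}b_if(y_i)\le\sum_{j=1}^{l}a_jf(x_j)-c\left(\sum_{j=1}^{l}a_jx_j^2-\sum_{i=1}^{m}b_iy_i^2\right).$$
   Context: A function $f:[\alpha,\beta]\to\mathbb{R}$ is strongly convex with modulus $c>0$ if $f(\lambda x+(1-\lambda)y)\le\lambda f(x)+(1-\lambda)f(y)-c\lambda(1-\lambda)(x-y)^2$ for all $x,y\in[\alpha,\beta]$ and $\lambda\in[0,1]$. Weighted majorization: $(\mathbf{y},\mathbf{b})\prec(\mathbf{x},\mathbf{a})$ means that there exists a row stochastic matrix $\mathbf{A}=(a_{ij})\in\mathcal{M}_{ml}(\mathbb{R})$ ($m$ rows, $l$ columns, nonnegative entries, each row sum equal to $1$) such that $a_j=\sum_{i=1}^m b_ia_{ij}$ for $j=1,\dots,l$ and $y_i=\sum_{j=1}^l x_ja_{ij}$ for $i=1,\dots,m$ (in matrix form, $\mathbf{a}=\mathbf{b}\mathbf{A}$ and $\mathbf{y}=\mathbf{x}\mathbf{A}^T$).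 *)

(* Defs.v *)
From mathcomp Require Import all_boot all_order all_algebra.
From mathcomp Require Import reals.

Set Implicit Arguments.
Unset Strict Implicit.
Unset Printing Implicit Defensive.

Import Order.TTheory GRing.Theory Num.Theory.
Local Open Scope ring_scope.

(* A function [alpha, beta] -> R is represented by a total f : R -> R of which
   only the values on [alpha, beta] are ever used. *)
Definition strongly_convex (R : realType) (alpha beta c : R) (f : R -> R) : Prop :=
  0 < c /\
  forall x y lambda : R,
    x \in `[alpha, beta] -> y \in `[alpha, beta] -> lambda \in `[0, 1] ->
    f (lambda * x + (1 - lambda) * y) <=
      lambda * f x + (1 - lambda) * f y
      - c * lambda * (1 - lambda) * (x - y) ^+ 2.

Definition row_stochastic (R : realType) (m l : nat) (A : 'M[R]_(m, l)) : Prop :=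
  (forall i j, 0 <= A i j) /\ (forall i, \sum_j A i j = 1).

(* (y, b) \prec (x, a): the majorized pair comes first. *)
Definition weighted_majorization (R : realType) (m l : nat)
    (y b : 'rV[R]_m) (x a : 'rV[R]_l) : Prop :=
  exists A : 'M[R]_(m, l),
    [/\ row_stochastic A, a = b *m A & y = x *m A^T].

(* Main.v *)
(* Strong convexity of [f] with modulus [c] is convexity of [f t - c t^2];
   Jensen's inequality for this function along each row of the stochastic
   matrix, weighted by [b] and summed over the rows, gives the result. *)
Require Import Defs.
From mathcomp Require Import all_boot all_order all_algebra.
From mathcomp Require Import reals ring lra.

Set Implicit Arguments.
Unset Strict Implicit.
Unset Printing Implicit Defensive.

Import Order.TTheory GRing.Theory Num.Theory.
Local Open Scope ring_scope.

(** By the identity [t x^2 + (1 - t) z^2 - (t x + (1 - t) z)^2 = t (1 - t) (x - z)^2], subtracting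
    [c t^2] absorbs the strong convexity term exactly. *)
Lemma strongly_convex_sub_sqr (R : realType) (alpha beta c : R) (f : R -> R) :
  strongly_convex alpha beta c f ->
  forall x z t : R,
    x \in `[alpha, beta] -> z \in `[alpha, beta] -> t \in `[0, 1] ->
    f (t * x + (1 - t) * z) - c * (t * x + (1 - t) * z) ^+ 2 <=
      t * (f x - c * x ^+ 2) + (1 - t) * (f z - c * z ^+ 2).
Proof.
move=> [_ cvx_f] x z t xI zI tI.
rewrite lerBlDr (le_trans (cvx_f _ _ _ xI zI tI))// le_eqVlt.
by apply/orP; left; apply/eqP; ring.
Qed.

Section Jensen.
Variables (R : realFieldType) (alpha beta : R) (g : R -> R).
Hypothesis leab : alpha <= beta.
Hypothesis cvx_g : forall x z t : R,
  x \in `[alpha, beta] -> z \in `[alpha, beta] -> t \in `[0, 1] ->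
  g (t * x + (1 - t) * z) <= t * g x + (1 - t) * g z.

(* The barycentre is existentially quantified so that a zero total weight
   needs no division. *)
Lemma jensen_weighted (I : Type) (r : seq I) (w x : I -> R) :
  (forall i, 0 <= w i) -> (forall i, x i \in `[alpha, beta]) ->
  exists z, [/\ z \in `[alpha, beta],
    \sum_(i <- r) w i * x i = (\sum_(i <- r) w i) * z
    & (\sum_(i <- r) w i) * g z <= \sum_(i <- r) w i * g (x i)].
Proof.
move=> w0 xI; elim: r => [|i r [z [zI Sz Jz]]].
  by exists alpha; rewrite !big_nil !mul0r in_itv/= lexx leab.
rewrite !big_cons; have W0 : 0 <= \sum_(j <- r) w j by exact: sumr_ge0.
move: (\sum_(j <- r) w j) W0 Sz Jz => W W0 -> Jz.
(* If the total weight vanishes, nonnegativity makes [w i] and [W] both zero, and the old barycentre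
   [z] still serves. *)
have wi0 := w0 i; have [wW0|wW0] := eqVneq (w i + W) 0.
  have wi_eq0 : w i = 0 by lra.
  by exists z; split; rewrite // wi_eq0 !mul0r !add0r.
have wWp : 0 < w i + W by rewrite lt_neqAle eq_sym wW0 addr_ge0.
(* [t] is the share of the new point in the total weight; mixing [x i] and [z] in proportions [t]
   and [1 - t] gives the new barycentre. *)
have [t tI tE] : exists2 t, t \in `[0, 1] & (w i + W) * t = w i.
  exists (w i / (w i + W)); last by rewrite mulrC divfK.
  by rewrite in_itv/= divr_ge0 ?(ltW wWp)// ler_pdivrMr// mul1r lerDl.
have t1E : (w i + W) * (1 - t) = W by rewrite mulrBr tE; ring.
exists (t * x i + (1 - t) * z); split.
- have := xI i; move: tI zI; rewrite !in_itv/=.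
  by move=> /andP[? ?] /andP[? ?] /andP[? ?]; apply/andP; split; nra.
- by rewrite mulrDr !mulrA tE t1E.
- apply: le_trans (lerD (lexx _) Jz).
  (* Both sides become multiples of [w i + W]; cancelling this positive factor leaves two-point
     convexity. *)
  rewrite -{2}tE -{3}t1E -!mulrA -mulrDr ler_pM2l//.
  exact: cvx_g.
Qed.

(** With total weight 1, the barycentre [z] can only be the weighted mean itself. *)
Lemma jensen (I : finType) (w x : I -> R) :
  (forall i, 0 <= w i) -> \sum_i w i = 1 ->
  (forall i, x i \in `[alpha, beta]) ->
  g (\sum_i w i * x i) <= \sum_i w i * g (x i).
Proof.
move=> w0 w1 xI.
have [z [_]] := jensen_weighted (index_enum I) w0 xI.
by rewrite w1 !mul1r => ->.
Qed.

End Jensen.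

Theorem theorem2 (R : realType) (alpha beta : R) (hab : alpha < beta)
    (l m : nat) (x a : 'rV[R]_l) (y b : 'rV[R]_m)
    (hx : forall j, x 0 j \in `[alpha, beta])
    (hy : forall i, y 0 i \in `[alpha, beta])
    (ha : forall j, 0 <= a 0 j)
    (hb : forall i, 0 <= b 0 i)
    (hmaj : weighted_majorization y b x a)
    (c : R) (f : R -> R)
    (hf : strongly_convex alpha beta c f) :
  \sum_(i < m) b 0 i * f (y 0 i) <=
    \sum_(j < l) a 0 j * f (x 0 j)
    - c * (\sum_(j < l) a 0 j * x 0 j ^+ 2 - \sum_(i < m) b 0 i * y 0 i ^+ 2).
Proof.
case: hmaj => A [[A_ge0 A_sum1] aE yE].
pose g t := f t - c * t ^+ 2.
(* Substituting [a = b *m A] and exchanging the sums turns weights [a] into row averages weighted by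
   [b]. *)
have aS h : \sum_j a 0 j * h j = \sum_i b 0 i * \sum_j A i j * h j.
  rewrite aE; under eq_bigr => j _ do rewrite mxE mulr_suml.
  rewrite exchange_big; apply: eq_bigr => i _.
  by rewrite mulr_sumr; apply: eq_bigr => j _; rewrite mulrA.
have g_split n (p q : 'rV[R]_n) : \sum_i p 0 i * g (q 0 i) =
    \sum_i p 0 i * f (q 0 i) - c * \sum_i p 0 i * q 0 i ^+ 2.
  by rewrite mulr_sumr -sumrB; apply: eq_bigr => i _; rewrite /g; ring.
suff : \sum_i b 0 i * g (y 0 i) <= \sum_j a 0 j * g (x 0 j).
  by rewrite !g_split; lra.
(* Since [b] is nonnegative, it is enough to compare row by row: [y 0 i] is the mean of [x] under
   row [i] of [A], so Jensen applies. *)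
rewrite aS; apply: ler_sum => i _; apply: ler_wpM2l => //.
have -> : y 0 i = \sum_j A i j * x 0 j.
  by rewrite yE mxE; apply: eq_bigr => j _; rewrite mxE mulrC.
apply: (jensen (ltW hab)) => //.
exact: strongly_convex_sub_sqr hf.
Qed.
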